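(* Let $\tau>0$, let $f:[0,\infty)\to[0,\infty)$ be an $S$-map, and let $K$ be the unique fixed point of $f$. Consider the delay differential equation $$x'(t)=-x(t)+f(x(t-\tau)),\qquad ( * )$$ and define $g:[0,\infty)\to[0,\infty)$ by $$g(x)=(1-e^{-\tau})f(x)+e^{-\tau}K.$$ Then: (a) If $(1-e^{-\tau})|f'(K)|\le 1$, then $\lim_{t\to\infty}x(t)=K$ for every nonnegative solution $x(t)$ of $( * )$. (b) If $(1-e^{-\tau})|f'(K)|>1$, then $$\alpha_1\le\liminf_{t\to\infty}x(t)\le\limsup_{t\to\infty}x(t)\le\beta_1$$ for every nonnegative solution $x(t)$ of $( * )$, where $\{\alpha_1,\beta_1\}$, $\alpha_1<\beta_1$, is the unique $2$-cycle of $g$.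
   Context: For a $C^3$ map $f$, the Schwarzian derivative is $(Sf)(x)=\frac{f'''(x)}{f'(x)}-\frac32\left(\frac{f''(x)}{f'(x)}\right)^2$ whenever $f'(x)\neq 0$. A map $f:I\to I$, with $I=[0,\infty)$, is an $S$-map if it is three times differentiable, and $(Sf)(x)<0$ and $f'(x)<0$ for all $x\in I$. A $2$-cycle of $g$ is a set $\{\alpha_1,\beta_1\}$ with $\alpha_1\ne\beta_1$, $g(\alpha_1)=\beta_1$ and $g(\beta_1)=\alpha_1$. A nonnegative solution of $( * )$ is a continuous function $x:[-\tau,\infty)\to[0,\infty)$, determined by a continuous nonnegative initial function on $[-\tau,0]$, which is differentiable and satisfies $( * )$ for all $t>0$. *)

(* Defs.v *)
From mathcomp Require Import all_boot all_order all_algebra.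
From mathcomp Require Import all_classical all_reals all_analysis.
Set Implicit Arguments.
Unset Strict Implicit.
Unset Printing Implicit Defensive.
Import Order.TTheory GRing.Theory Num.Theory.
Import numFieldNormedType.Exports.
Local Open Scope classical_set_scope.
Local Open Scope ring_scope.

(* Differentiation on I = [0, +oo[ for functions R -> R, of which only the
   values on I matter: at 0 the increment h ranges over h > 0, so the derivative
   there is the right derivative.  At x > 0 this is the ordinary derivative, see
   derivIE. *)
Definition diffquotI (R : realType) (f : R -> R) (x : R) : set_system R :=
  h^-1 * (f (h + x) - f x) @[h --> within [set h | 0 <= h + x] 0^'].

Definition derivableI (R : realType) (f : R -> R) (x : R) : Prop :=
  cvg (diffquotI f x).

Definition derivI (R : realType) (f : R -> R) (x : R) : R :=
  lim (diffquotI f x).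

Lemma derivIE (R : realType) (f : R -> R) (x : R) : 0 < x ->
  (derivableI f x <-> derivable f x 1) /\ derivI f x = derive1 f x.
Proof.
move=> x0.
have FE : within [set h | 0 <= h + x] 0^' = (0 : R)^'.
  apply/seteqP; split => A; last exact: cvg_within.
  move=> AF; have xF : \forall h \near (0 : R)^', 0 <= h + x.
    apply: nbhs_dnbhs; near=> h.
    rewrite -lerBlDr sub0r ltW//; near: h.
    by apply: lt_nbhsr; rewrite oppr_lt0.
  have AF' : \forall h \near (0 : R)^', 0 <= h + x -> A h := AF.
  by apply: (filterS2 _ _ AF' xF) => h hA hx; exact: hA.
have E : diffquotI f x =
    ((fun h : R => h^-1 *: ((f \o shift x) (h *: (1 : R)) - f x)) @ 0^').
  rewrite /diffquotI FE.
  have -> // : (fun h : R => h^-1 *: ((f \o shift x) (h *: (1 : R)) - f x)) =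
    (fun h : R => h^-1 * (f (h + x) - f x)).
  by apply/funext => h; rewrite /= /GRing.scale /= mulr1.
by rewrite /derivableI /derivI E derive1E.
Unshelve. all: by end_near.
Qed.

Definition derivnI (R : realType) (n : nat) (f : R -> R) : R -> R :=
  iter n (@derivI R) f.

Definition schwarzian (R : realType) (f : R -> R) (x : R) : R :=
  derivnI 3 f x / derivI f x - 3 / 2 * (derivnI 2 f x / derivI f x) ^+ 2.

Definition S_map (R : realType) (f : R -> R) : Prop :=
  [/\ forall x, 0 <= x -> 0 <= f x,
      forall n x, (n < 3)%N -> 0 <= x -> derivableI (derivnI n f) x,
      forall x, 0 <= x -> schwarzian f x < 0
    & forall x, 0 <= x -> derivI f x < 0].

Definition fixed_point (R : realType) (f : R -> R) (K : R) : Prop :=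
  0 <= K /\ f K = K.

Definition two_cycle (R : realType) (g : R -> R) (C : set R) : Prop :=
  exists a b : R,
    [/\ 0 <= a, 0 <= b, a != b, g a = b & g b = a] /\ C = [set a; b].

(* Only the values of x on [-tau, +oo[ matter; the initial function is the
   restriction of x to [-tau, 0]. *)
Definition nonneg_solution (R : realType) (tau : R) (f x : R -> R) : Prop :=
  [/\ forall t, - tau <= t -> 0 <= x t,
      {within `[- tau, +oo[, continuous x}
    & forall t : R, 0 < t -> is_derive t 1 x (- x t + f (x (t - tau)))].

(* Main.v *)
(* Negative Schwarzian derivative means that |f'|^{-1/2} is strictly convex;
   comparing it with its tangent at b gives, for t <> b,
     f'(b) < (f(t) - f(b)) / (t - b) * (1 - f''(b) / (2 f'(b)) * (t - b)).
   The map g inherits this inequality.  Written at b and at g(b), it forces the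
   middle one of three fixed points of g o g to be repelling, without computing
   the Schwarzian derivative of g o g.  Hence g o g has no fixed point below K
   if |g'(K)| <= 1, and exactly one, alpha1, if |g'(K)| > 1.

   For a solution x, let a be the supremum of the a' in [0, K] that are
   eventually <= x.  Variation of constants over one delay shows that eventually
   x <= g(a') + e whenever eventually a' <= x, and symmetrically from above.  So
   x is attracted by [a, g(a)] and g(g(a)) <= a, hence a = K in case (a) and
   alpha1 <= a in case (b). *)
Require Import Defs.
From mathcomp Require Import all_boot all_order all_algebra.
From mathcomp Require Import all_classical all_reals all_analysis.
From mathcomp Require Import ring lra.
Set Implicit Arguments.
Unset Strict Implicit.
Unset Printing Implicit Defensive.
Import Order.TTheory GRing.Theory Num.Theory.
Import numFieldNormedType.Exports.
Local Open Scope classical_set_scope.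
Local Open Scope ring_scope.

(** * The tangent inequality for maps with negative Schwarzian derivative *)

Section schwarzian.
Variable R : realType.
Implicit Types (f : R -> R) (a b s t x : R).

Lemma is_derive_continuous f x df : is_derive x 1 f df -> {for x, continuous f}.
Proof.
by move=> fx; apply/differentiable_continuous/derivable1_diffP/ex_derive.
Qed.

Lemma derive_within_continuous f df a b :
  (forall x, a <= x <= b -> is_derive x 1 f (df x)) ->
  {within `[a, b], continuous f}.
Proof.
move=> fdf; apply: derivable_within_continuous => x.
by rewrite in_itv/= => /fdf fx; exact: ex_derive.
Qed.

Lemma mvt_closed f df a b : a < b ->
  (forall x, a <= x <= b -> is_derive x 1 f (df x)) ->
  exists2 c, a < c < b & f b - f a = df c * (b - a).
Proof.
move=> ab fdf.
have [|c|c] := MVT (f := f) (df := df) ab.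
- by move=> x; rewrite in_itv/= => /andP[? ?]; apply: fdf; rewrite !ltW.
- exact: derive_within_continuous fdf c.
- by rewrite in_itv/= => cab fE; exists c.
Qed.

(** The sign of [(x - a) * (b - x)] says that [x] lies between [a] and [b] in either order, so that
    later arguments treat both sides of a point at once. *)
Lemma mvt_between f df a b : a != b ->
  (forall x, 0 <= (x - a) * (b - x) -> is_derive x 1 f (df x)) ->
  exists2 c, 0 < (c - a) * (b - c) & f b - f a = df c * (b - a).
Proof.
move=> + fdf; rewrite neq_lt => /orP[ab|ba].
- have [x /andP[ax xb]|c /andP[ac cb] fE] := mvt_closed ab (f := f) (df := df).
    by apply: fdf; nra.
  by exists c => //; apply: mulr_gt0; lra.
- have [x /andP[ax xb]|c /andP[ac cb] fE] := mvt_closed ba (f := f) (df := df).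
    by apply: fdf; nra.
  by exists c; [rewrite nmulr_lgt0; lra|nra].
Qed.

Lemma between_gt0 a b x : 0 < a -> 0 < b -> 0 <= (x - a) * (b - x) -> 0 < x.
Proof. by move=> a0 b0 xab; rewrite ltNge; apply/negP => x0; nra. Qed.

Section tangent.
Variables f f1 f2 f3 : R -> R.
Hypothesis ff1 : forall x, 0 < x -> is_derive x 1 f (f1 x).
Hypothesis f1f2 : forall x, 0 < x -> is_derive x 1 f1 (f2 x).
Hypothesis f2f3 : forall x, 0 < x -> is_derive x 1 f2 (f3 x).
Hypothesis f1_lt0 : forall x, 0 < x -> f1 x < 0.
Hypothesis Sf_lt0 :
  forall x, 0 < x -> f3 x / f1 x - 3 / 2 * (f2 x / f1 x) ^+ 2 < 0.

(** [phi] is $|f'|^{-1/2}$ and [psi] is its derivative. *)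
Let phi x := expR (- (1 / 2) * ln (- f1 x)).
Let psi x := phi x * (- (1 / 2) * (f2 x / f1 x)).

Let phi_gt0 x : 0 < phi x. Proof. exact: expR_gt0. Qed.

Let phi2 x : 0 < x -> phi x ^+ 2 * - f1 x = 1.
Proof.
move=> x0; rewrite expr2 -expRD -[X in _ * X]lnK ?posrE ?oppr_gt0 ?f1_lt0//.
by rewrite -expRD [X in expR X](_ : _ = 0) ?expR0//; lra.
Qed.

Let phi_psi x : 0 < x -> is_derive x 1 phi (psi x).
Proof.
move=> x0; have := f1_lt0 x0 => f1x; have ? := f1f2 x0.
have ? : is_derive (- f1 x) 1 (@ln R) (- f1 x)^-1.
  by apply: is_derive1_ln; rewrite oppr_gt0.
have ? : is_derive x 1 (fun y => ln (- f1 y)) ((- f1 x)^-1 * - f2 x).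
  exact: (@is_derive1_comp _ (@ln R) (fun y => - f1 y)).
have ? : is_derive x 1 (fun y => - (1 / 2) * ln (- f1 y))
   (- (1 / 2) * ((- f1 x)^-1 * - f2 x)).
  exact: (@is_deriveZ _ _ _ (fun y => ln (- f1 y))).
apply: (is_derive_eq (@is_derive1_comp _ (@expR R) _ _ _ _ _ _)).
by rewrite /psi /phi; field; lra.
Qed.

(** This is $\varphi''=-\frac12\varphi\,Sf$: a negative Schwarzian derivative makes [phi] strictly
    convex. *)
Let psi' x : 0 < x -> is_derive x 1 psi
  (- (1 / 2) * phi x * (f3 x / f1 x - 3 / 2 * (f2 x / f1 x) ^+ 2)).
Proof.
move=> x0; have := f1_lt0 x0 => f1x; have ? := f1f2 x0; have ? := f2f3 x0.
have ? := phi_psi x0.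
have ? : is_derive x 1 (fun y => (f1 y)^-1) (- (f1 x) ^- 2 *: f2 x).
  by apply: is_deriveV; lra.
apply: is_derive_eq.
rewrite /psi /GRing.scale/=; field; lra.
Qed.

Let psi_lt a b : 0 < a -> a < b -> psi a < psi b.
Proof.
move=> a0 ab; rewrite -subr_gt0.
have [x /andP[ax xb]|c /andP[ac cb] ->] := mvt_closed ab (f := psi)
  (df := fun x => - (1 / 2) * phi x * (f3 x / f1 x - 3 / 2 * (f2 x / f1 x) ^+ 2)).
  by apply: psi'; lra.
have c0 : 0 < c by lra.
have := Sf_lt0 c0; have := phi_gt0 c; set u := phi c; set v := _ - _ => u0 v0.
by apply: mulr_gt0; nra.
Qed.

Let phi_tangent b t : 0 < b -> 0 < t -> t != b ->
  phi b + psi b * (t - b) < phi t.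
Proof.
move=> b0 t0; rewrite eq_sym => tb.
have [x /(between_gt0 b0 t0)|c ctb E] := mvt_between tb (f := phi) (df := psi).
  exact: phi_psi.
have c0 := between_gt0 b0 t0 (ltW ctb).
have [bt|bt] : b < t \/ t < b by move: tb; rewrite neq_lt => /orP.
  have bc : b < c by nra.
  have := psi_lt b0 bc; nra.
have cb : c < b by nra.
have := psi_lt c0 cb; nra.
Qed.

(** Let [l] be the tangent of [phi] at [b]. Where [l] is positive, $\varphi>l$ off [b] turns into
    $f'=-\varphi^{-2}>-l^{-2}$, and $l^{-2}$ has an explicit primitive; the mean value theorem then
    gives the claim. *)
Lemma tangent_lt b t : 0 < b -> 0 < t -> t != b ->
  f1 b < (f t - f b) / (t - b) * (1 - f2 b / (2 * f1 b) * (t - b)).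
Proof.
move=> b0 t0 tb; set P := phi b; set Q := psi b.
have P0 : 0 < P := phi_gt0 b.
have f1b : f1 b = - P ^- 2.
  by have := phi2 b0; rewrite -/P => PE; apply: (mulfI (_ : P ^+ 2 != 0));
    rewrite ?expf_neq0 ?gt_eqF// mulrN divff ?expf_neq0 ?gt_eqF//; lra.
pose l x := P + Q * (x - b).
have -> : 1 - f2 b / (2 * f1 b) * (t - b) = l t / P.
  have := f1_lt0 b0; rewrite /l /Q /psi -/P => ?; field; lra.
have bt : b != t by rewrite eq_sym.
(* If [l t <= 0], the right-hand side is a product of two nonpositive factors, whereas
   [f1 b < 0]. *)
have [lt0|lt0] := leP (l t) 0.
  have [x /(between_gt0 b0 t0)|c ctb ->] := mvt_between bt (f := f) (df := f1).
    exact: ff1.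
  have c0 := between_gt0 b0 t0 (ltW ctb).
  rewrite mulfK ?subr_eq0//; apply: (lt_le_trans (f1_lt0 b0)).
  apply: mulr_le0; first exact/ltW/f1_lt0.
  by rewrite pmulr_lle0 ?invr_gt0.
have l_gt0 x : 0 <= (x - b) * (t - x) -> 0 < l x.
  move: lt0; rewrite /l => lt0 xbt; rewrite ltNge; apply/negP => lx.
  move: tb; rewrite neq_lt => /orP[tb|tb].
    by nra.
  by nra.
(* The added fraction vanishes at [b] and has derivative $l^{-2}$, so [D] has positive derivative
   strictly between [b] and [t]. *)
pose D x := f x + (x - b) / (P * l x).
have DD x : 0 <= (x - b) * (t - x) -> is_derive x 1 D (f1 x + l x ^- 2).
  move=> xbt; have lx := l_gt0 x xbt.
  have ? := ff1 (between_gt0 b0 t0 xbt).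
  have ? : is_derive x 1 l Q.
    by apply: is_derive_eq; rewrite /GRing.scale/=; lra.
  have ? : is_derive x 1 (fun y => P * l y) (P * Q).
    exact: (@is_deriveZ _ _ _ l).
  have ? : is_derive x 1 (fun y => (P * l y)^-1) (- (P * l x) ^- 2 *: (P * Q)).
    by apply: is_deriveV; rewrite gt_eqF ?mulr_gt0.
  apply: is_derive_eq; rewrite /GRing.scale/=.
  have lE : Q * (x - b) = l x - P by rewrite /l; ring.
  transitivity (f1 x + (P * l x)^-1 - P * (Q * (x - b)) * (P * l x) ^- 2).
    by field; lra.
  by rewrite lE; field; lra.
have [c ctb DE] := mvt_between bt DD.
have c0 := between_gt0 b0 t0 (ltW ctb).
have lc := l_gt0 c (ltW ctb).
have lphi : l c < phi c.
  apply: phi_tangent => //.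
  by apply: contraTneq ctb => ->; rewrite subrr mul0r ltxx.
have D'_gt0 : 0 < f1 c + l c ^- 2.
  have -> : f1 c = - phi c ^- 2.
    have := phi2 c0 => PE; apply: (mulfI (_ : phi c ^+ 2 != 0));
      rewrite ?expf_neq0 ?gt_eqF// mulrN divff ?expf_neq0 ?gt_eqF//; lra.
  rewrite addrC subr_gt0 ltf_pV2 ?posrE ?exprn_gt0//.
  by rewrite ltr_pXn2r ?nnegrE ?ltW.
have tb2 : 0 < (t - b) ^+ 2 by rewrite exprn_even_gt0//= subr_eq0.
have lP : 0 < l t / P by rewrite divr_gt0.
have fE : f t - f b = (f1 c + l c ^- 2 - (P * l t)^-1) * (t - b).
  by rewrite mulrBl -DE /D subrr mul0r; ring.
rewrite fE mulfK ?subr_eq0//.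
rewrite mulrBl (_ : (P * l t)^-1 * (l t / P) = P ^- 2); last by field; lra.
by rewrite f1b ltrDr mulr_gt0.
Qed.
End tangent.
End schwarzian.

(** * Intermediate values, last crossings and the local effect of a positive derivative *)

Section crossing.
Variable R : realType.
Implicit Types (f : R -> R) (a b s t u x : R).

Lemma ivt_point f a b v : a <= b ->
  (forall x, a <= x <= b -> {for x, continuous f}) ->
  f a <= v <= f b \/ f b <= v <= f a -> exists2 c, a <= c <= b & f c = v.
Proof.
move=> ab fc fv; have [||c] := @IVT R f a b v ab.
- by apply: continuous_in_subspaceT => x; rewrite inE/= in_itv/=; exact: fc.
- rewrite ge_min le_max.
  by case: fv => /andP[-> ->]; rewrite ?orbT.
- by rewrite in_itv/= => cab fE; exists c.
Qed.

(** The point is the supremum of those in [[s, t]] where [f <= k]. Continuity gives [f <= k] there;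
    were it strict, the intermediate value theorem would yield a later point with value [k]. *)
Lemma last_crossing f s t k : s <= t ->
  (forall x, s <= x <= t -> {for x, continuous f}) ->
  f s <= k -> k < f t ->
  exists u, [/\ s <= u < t, f u = k & forall x, u < x <= t -> k < f x].
Proof.
move=> st fc fs ft.
pose S := [set x | s <= x <= t /\ f x <= k].
have Ss : S s by split=> //; rewrite lexx.
have hS : has_sup S.
  by split; [exists s|exists t => x [/andP[]]].
have su : s <= sup S by exact: sup_upper_bound.
have ut : sup S <= t by apply: ge_sup; [exists s|move=> x [/andP[]]].
have above x : sup S < x <= t -> k < f x.
  move=> /andP[ux xt]; rewrite ltNge; apply/negP => fx.
  have : S x by split=> //; rewrite xt (le_trans su (ltW ux)).
  by move/(sup_upper_bound hS); rewrite leNgt ux.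
have fuk : f (sup S) <= k.
  rewrite leNgt; apply/negP => kfu.
  have /nbhs_ballP[e /= e0 eP] : \forall x \near sup S, k < f x.
    have := fc (sup S); rewrite su ut => /(_ isT) cu; exact: (cvgr_gt _ cu).
  have [x Sx ux] := sup_adherent e0 hS.
  have : k < f x.
    apply: eP; rewrite /ball/= ger0_norm ?subr_ge0 ?sup_upper_bound//; lra.
  by case: Sx => _; rewrite leNgt => /negP.
have uk : sup S < t.
  by rewrite lt_neqAle ut andbT; apply: contraTneq ft => <-; rewrite -leNgt.
exists (sup S); split => //; first by rewrite su.
apply/le_anti; rewrite fuk/= leNgt; apply/negP => fu.
have [||c /andP[uc ct] fck] := @ivt_point f (sup S) t k ut.
- by move=> x /andP[ux xt]; apply: fc; rewrite xt andbT (le_trans su).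
- by left; rewrite fuk ltW.
move: uc; rewrite le_eqVlt => /orP[/eqP uc|uc].
  by move: fu; rewrite uc fck ltxx.
by have := above c; rewrite uc ct fck ltxx => /(_ isT).
Qed.

Lemma derive_gt0_near f x l : is_derive x 1 f l -> 0 < l ->
  \forall y \near x, y != x -> 0 < (f y - f x) * (y - x).
Proof.
move=> /is_derive1_caratheodory[g [fE gc gx]] l0.
near=> y => yx; rewrite fE -mulrA mulr_gt0//.
  by near: y; apply: (cvgr_gt _ gc); rewrite gx.
by rewrite -expr2 exprn_even_gt0//= subr_eq0.
Unshelve. all: by end_near. Qed.

End crossing.

(** * Fixed points of [g] composed with itself, for a decreasing [g] satisfying the tangent
    inequality *)

Section two_cycle.
Variables (R : realType) (g g1 T : R -> R) (K m : R).
Implicit Types a b c t u v x : R.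
Hypothesis gg1 : forall x, 0 < x -> is_derive x 1 g (g1 x).
Hypothesis g1_lt0 : forall x, 0 < x -> g1 x < 0.
Hypothesis g_tangent_lt : forall b t, 0 < b -> 0 < t -> t != b ->
  g1 b < (g t - g b) / (t - b) * (1 - T b * (t - b)).
Hypothesis m_gt0 : 0 < m.
Hypothesis g_gtm : forall x, 0 < x -> m < g x.
Hypothesis K_gt0 : 0 < K.
Hypothesis gK : g K = K.

Let g_gt0 x : 0 < x -> 0 < g x.
Proof. by move=> /g_gtm; apply: lt_trans. Qed.

Let g_decr a b : 0 < a -> a < b -> g b < g a.
Proof.
move=> a0 ab; rewrite -subr_lt0.
have [x /andP[ax xb]|c /andP[ac cb] ->] := mvt_closed ab (f := g) (df := g1).
  by apply: gg1; lra.
by have := g1_lt0 (lt_trans a0 ac); nra.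
Qed.

Let gg x := g (g x).

Let gg_derive x : 0 < x -> is_derive x 1 gg (g1 (g x) * g1 x).
Proof.
move=> x0; have := gg1 x0; have := gg1 (g_gt0 x0) => ? ?.
exact: (@is_derive1_comp _ g g).
Qed.

(** Since [gg] fixes [a], [b] and [c], the chord slopes of [g] at [g b] are [X] and [Y], the
    reciprocals of those at [b]. Combining the four tangent inequalities eliminates the coefficients
    [T], whose values therefore do not matter. *)
Lemma gg_repelling a b c : 0 < a -> a < b -> b < c ->
  gg a = a -> gg b = b -> gg c = c -> 1 < g1 (g b) * g1 b.
Proof.
move=> a0 ab bc ga gb gc.
have b0 : 0 < b by lra.
have c0 : 0 < c by lra.
have gab := g_decr a0 ab; have gbc := g_decr b0 bc.
have na : a != b by rewrite lt_eqF.
have nc : c != b by rewrite gt_eqF.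
have nga : g a != g b by rewrite gt_eqF.
have ngc : g c != g b by rewrite lt_eqF.
have := g_tangent_lt (g_gt0 b0) (g_gt0 a0) nga.
have := g_tangent_lt (g_gt0 b0) (g_gt0 c0) ngc.
have := g_tangent_lt b0 a0 na.
have := g_tangent_lt b0 c0 nc.
rewrite -[g (g a)]/(gg a) -[g (g b)]/(gg b) -[g (g c)]/(gg c) ga gb gc.
have := g1_lt0 b0; have := g1_lt0 (g_gt0 b0).
set P' := g1 (g b); set P := g1 b; set t := T b; set t' := T (g b).
set X := (c - b) / (g c - g b); set Y := (a - b) / (g a - g b) => P'0 P0.
have X0 : X < 0 by rewrite /X pmulr_rlt0 ?invr_lt0; lra.
have Y0 : Y < 0 by rewrite /Y nmulr_rlt0 ?invr_gt0; lra.
rewrite -[_ / (c - b)]invf_div -[_ / (a - b)]invf_div -/X -/Y.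
rewrite !ltr_ndivlMl// => Pc Pa.
have XE : X * (g c - g b) = c - b by rewrite divfK// subr_eq0.
have YE : Y * (g a - g b) = a - b by rewrite divfK// subr_eq0.
rewrite ![_ * (1 - _)]mulrBr !mulr1 [X * _]mulrCA [Y * _]mulrCA XE YE.
move=> P'c P'a.
(* With weights [b - a] for [c] and [c - b] for [a], the terms in [t'] cancel here and those in [t]
   cancel in [Ple]. The common sum is negative, and multiplying [P'le] by [P < 0] links the two
   bounds. *)
have P'le : (c - a) * P' < (b - a) * X + (c - b) * Y by nra.
have Ple : c - a < P * ((b - a) * X + (c - b) * Y) by nra.
have : (c - a) * 1 < (c - a) * (P' * P) by nra.
by rewrite ltr_pM2l; lra.
Qed.

(** All values of [gg] at positive points exceed [m], so [gg] is above the diagonal at [m] and meets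
    it on [[m, p]]. *)
Lemma gg_fixed_le p : 0 < p -> gg p <= p -> exists2 q, 0 < q <= p & gg q = q.
Proof.
move=> p0 gp; have gpm := g_gtm (g_gt0 p0).
have mp : m <= p by apply: ltW; exact: lt_le_trans gp.
pose D x := gg x - x.
have [||q /andP[mq qp]] := @ivt_point R D m p 0 mp.
- move=> x /andP[mx xp]; have ? := gg_derive (lt_le_trans m_gt0 mx).
  by apply: (@is_derive_continuous _ D); exact: is_deriveB.
- right; rewrite /D subr_le0 gp subr_ge0 ltW//; exact/g_gtm/g_gt0.
rewrite /D => /eqP; rewrite subr_eq0 => /eqP qE; exists q => //.
by rewrite qp (lt_le_trans m_gt0 mq).
Qed.

(** A fixed point [q < K] of [gg] comes with [g q > K], so [K] is the middle one of three fixed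
    points. *)
Lemma gg_le_repelling p : 0 < p -> p < K -> gg p <= p -> 1 < g1 K ^+ 2.
Proof.
move=> p0 pK /(gg_fixed_le p0)[q /andP[q0 qp] qE].
have qK : q < K by exact: le_lt_trans pK.
rewrite expr2 -[X in g1 X * _]gK; apply: (gg_repelling q0 qK (c := g q)) => //.
- by rewrite -[X in X < _]gK; exact: g_decr.
- by rewrite /gg !gK.
- by rewrite /gg -/(gg q) qE.
Qed.

Hypothesis K_repelling : 1 < g1 K ^+ 2.

Let id_sub_gg_derive x : 0 < x ->
  is_derive x 1 (fun y => y - gg y) (1 - g1 (g x) * g1 x).
Proof. by move=> x0; have ? := gg_derive x0; exact: is_deriveB. Qed.

(** The slope of [gg] at [K] is [g1 K ^+ 2 > 1], which puts [gg] below the diagonal just to the left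
    of [K]. *)
Let gg_near_K p : 0 < p -> p < K -> exists2 d, p < d < K & gg d < d.
Proof.
move=> p0 pK.
have /derive_gt0_near : is_derive K 1 (fun y => gg y - y) (g1 (g K) * g1 K - 1).
  by have ? := gg_derive K_gt0; exact: is_deriveB.
rewrite gK -expr2 subr_gt0 => /(_ K_repelling) KE.
near K^'- => d.
exists d.
  by apply/andP; split; near: d; [exact: nbhs_left_gt|exact: nbhs_left_lt].
have dK : d < K by near: d; exact: nbhs_left_lt.
have /(_ (negbT (lt_eqF dK))) : d != K -> 0 < (gg d - d - (gg K - K)) * (d - K).
  near: d; apply: cvg_within; exact: KE.
by rewrite nmulr_lgt0 ?subr_lt0// /gg !gK; lra.
Unshelve. all: by end_near. Qed.

Lemma gg_fixed_exists : exists a, [/\ 0 < a, a < K & gg a = a].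
Proof.
have K0 := K_gt0; have [||d /andP[md dK] gd] := @gg_near_K (K / 2); [lra|lra|].
have d0 : 0 < d by lra.
have [a /andP[a0 ad] aE] := gg_fixed_le d0 (ltW gd).
by exists a; split => //; exact: le_lt_trans dK.
Qed.

(* Between two fixed points below K, take the last u at which gg u >= u: gg
   would cross the diagonal downwards at u, while it is repelling there. *)
Lemma gg_fixed_unique p q : 0 < p -> p < K -> 0 < q -> q < K ->
  gg p = p -> gg q = q -> p = q.
Proof.
wlog pq : p q / p < q.
  move=> wl p0 pK q0 qK pE qE; have [pq|qp|//] := ltgtP p q.
    exact: wl.
  by apply/esym/wl.
move=> p0 pK q0 qK pE qE.
have [d /andP[qd dK] gd] := gg_near_K q0 qK.
have [|||u [/andP[qu ud] uE above]] :=
    @last_crossing R (fun y => y - gg y) q d 0 (ltW qd).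
- move=> x /andP[qx xd]; apply: is_derive_continuous; apply: id_sub_gg_derive.
  exact: lt_le_trans qx.
- by rewrite qE subrr.
- by rewrite subr_gt0.
have ggu : gg u = u by move/eqP: uE; rewrite subr_eq0 => /eqP.
have u0 : 0 < u by exact: lt_le_trans qu.
have gK' : gg K = K by rewrite /gg !gK.
have := gg_repelling p0 (lt_le_trans pq qu) (lt_trans ud dK) pE ggu gK'.
have /derive_gt0_near : is_derive u 1 (fun y => gg y - y) (g1 (g u) * g1 u - 1).
  by have ? := gg_derive u0; exact: is_deriveB.
rewrite subr_gt0 => uD /uD {}uD.
near u^'+ => y.
have uy : u < y by near: y; exact: nbhs_right_gt.
have yd : y <= d by near: y; exact: nbhs_right_le.
have /(_ (negbT (gt_eqF uy))) : y != u -> 0 < (gg y - y - (gg u - u)) * (y - u).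
  near: y; apply: cvg_within; exact: uD.
have := above y; rewrite uy yd => /(_ isT).
by rewrite ggu subrr; nra.
Unshelve. all: by end_near. Qed.

End two_cycle.

(** * Asymptotic bounds for $x'=-x+F$ by variation of constants over one delay *)

Section delayed_decay.
Variable R : realType.
Implicit Types (x F : R -> R) (A K T r s t tau : R).

(** With the integrating factor $e^r$, the derivative of $(x-A)e^r$ is $e^r(F-A)\le 0$. *)
Lemma gronwall x F A s t : s <= t ->
  (forall r, s <= r <= t -> is_derive r 1 x (- x r + F r)) ->
  (forall r, s < r < t -> F r <= A) ->
  x t <= A + (x s - A) * expR (- (t - s)).
Proof.
rewrite le_eqVlt => /orP[/eqP <- _ _|st xF FA].
  by rewrite subrr oppr0 expR0; lra.
have [r rst|c cst] := mvt_closed st (f := fun r => (x r - A) * expR r)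
  (df := fun r => expR r * (F r - A)).
  by have ? := xF r rst; apply: is_derive_eq; rewrite /GRing.scale/=; ring.
have := FA c cst; have := expR_gt0 c; set E := expR c => E0 FcA xts.
have {}xts : (x t - A) * expR t <= (x s - A) * expR s.
  by case/andP: cst => ? ?; rewrite -subr_le0 xts; apply: mulr_le0_ge0; nra.
rewrite -lerBlDl opprB expRD expRN mulrA ler_pdivlMr ?expR_gt0//.
Qed.

(* Once x has reached K, an excursion above K starts from some s with x s = K;
   within [s, s + tau] it obeys the bound by F <= A, and afterwards the delayed
   argument is above K, so that F <= K and x decreases. *)
Lemma near_le_mean x F tau K A T : 0 < tau -> K <= A ->
  (forall t, T <= t -> is_derive t 1 x (- x t + F t)) ->
  (forall t, T <= t -> F t <= A) ->
  (forall t, T + tau <= t -> K <= x (t - tau) -> F t <= K) ->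
  forall e, 0 < e ->
  \forall t \near +oo, x t <= (1 - expR (- tau)) * A + expR (- tau) * K + e.
Proof.
move=> tau0 KA xF FA FK e e0; set B := _ * A + _ * K.
have E0 := expR_gt0 (- tau).
have E1 : expR (- tau) < 1 by rewrite expR_lt1 oppr_lt0.
have KB : K <= B by rewrite /B; nra.
have [[s [Ts xs]]|above] := pselect (exists s, T <= s /\ x s <= K).
- suff xB t : s <= t -> x t <= B.
    near=> t; have st : s <= t by near: t; exact/nbhs_pinfty_ge/num_real.
    by rewrite (le_trans (xB t st))// lerDl ltW.
  move=> st; have [xt|xt] := leP (x t) K; first exact: le_trans KB.
  have [|u [/andP[su ut] xu xK]] := last_crossing st _ xs xt.
    move=> r /andP[sr rt]; have := xF r (le_trans Ts sr).
    exact: is_derive_continuous.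
  have Tu := le_trans Ts su.
  have xleB r : u <= r <= t -> r <= u + tau -> x r <= B.
    move=> /andP[ur rt] rtau; apply: (le_trans (@gronwall x F A u r ur _ _)).
    + by move=> y /andP[uy _]; apply: xF; exact: le_trans uy.
    + by move=> y /andP[uy _]; apply: FA; exact: le_trans (ltW uy).
    (* Since [x u = K <= A], the bound increases with [r], and it equals [B] at [r = u + tau]. *)
    + have : expR (- tau) <= expR (- (r - u)) by rewrite ler_expR; lra.
      by rewrite xu /B; nra.
  have [tu|tu] := leP t (u + tau); first by apply: xleB => //; rewrite lexx ltW.
  have xutau : x (u + tau) <= B by apply: xleB; lra.
  apply: (le_trans (@gronwall x F K (u + tau) t (ltW tu) _ _)).
  + by move=> y /andP[uy _]; apply: xF; lra.
  + move=> y /andP[uy yt]; apply: FK; first by lra.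
    by apply/ltW/xK; apply/andP; split; lra.
  + have : expR (- (t - (u + tau))) <= 1 by rewrite expR_le1; lra.
    by have := expR_gt0 (- (t - (u + tau))); nra.
(* If [x] never comes down to [K], then [F <= K] from [T + tau] on, and the excess of [x] over [K]
   is at most [C] times a decaying exponential. *)
- have xK t : T <= t -> K < x t.
    by move=> Tt; rewrite ltNge; apply/negP => xt; apply: above; exists t.
  pose C := x (T + tau) - K.
  have C0 : 0 < C by rewrite subr_gt0 xK// lerDl ltW.
  near=> t.
  have Tt : T + tau <= t by near: t; exact/nbhs_pinfty_ge/num_real.
  (* A further time [C / e] brings the excess below [e], because $e^s\ge 1+s$. *)
  have Ct : T + tau + C / e <= t by near: t; exact/nbhs_pinfty_ge/num_real.
  apply: (le_trans (@gronwall x F K (T + tau) t Tt _ _)).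
  + by move=> y /andP[Ty _]; apply: xF; lra.
  + by move=> y /andP[Ty _]; apply: FK; [lra|apply/ltW/xK; lra].
  + apply: lerD => //; rewrite -/C expRN ler_pdivrMr ?expR_gt0//.
    rewrite mulrC -ler_pdivrMr//; apply: le_trans (expR_ge1Dx _); lra.
Unshelve. all: by end_near. Qed.

(** The equation is preserved when [x], [F], [A] and [K] all change sign. *)
Lemma near_ge_mean x F tau K A T : 0 < tau -> A <= K ->
  (forall t, T <= t -> is_derive t 1 x (- x t + F t)) ->
  (forall t, T <= t -> A <= F t) ->
  (forall t, T + tau <= t -> x (t - tau) <= K -> K <= F t) ->
  forall e, 0 < e ->
  \forall t \near +oo, (1 - expR (- tau)) * A + expR (- tau) * K - e <= x t.
Proof.
move=> tau0 AK xF FA FK e e0.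
have : \forall t \near +oo, - x t <=
    (1 - expR (- tau)) * - A + expR (- tau) * - K + e.
  apply: (@near_le_mean (fun t => - x t) (fun t => - F t) _ _ _ T) => //.
  - by rewrite lerN2.
  - by move=> t Tt; have ? := xF t Tt; apply: is_derive_eq; ring.
  - by move=> t Tt; rewrite lerN2; exact: FA.
  - by move=> t Tt; rewrite !lerN2; exact: FK.
by apply: filterS => t; lra.
Qed.

End delayed_decay.

(** * An attracting interval [[a, g a]] for each nonnegative solution *)

Section delay_equation.
Variables (R : realType) (tau : R) (f x : R -> R) (K : R).
Implicit Types a b e t y z : R.
Hypothesis tau_gt0 : 0 < tau.
Hypothesis f_decr : forall y z, 0 <= y -> y <= z -> f z <= f y.
Hypothesis f_continuous : forall y, 0 < y -> {for y, continuous f}.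
Hypothesis f_ge0 : forall y, 0 <= y -> 0 <= f y.
Hypothesis K_gt0 : 0 < K.
Hypothesis fK : f K = K.
Hypothesis x_sol : nonneg_solution tau f x.

Let d := expR (- tau).
Let g y := (1 - d) * f y + d * K.

Let d_gt0 : 0 < d. Proof. exact: expR_gt0. Qed.
Let d_lt1 : d < 1. Proof. by rewrite expR_lt1 oppr_lt0. Qed.

Let g_decr y z : 0 <= y -> y <= z -> g z <= g y.
Proof.
by move=> y0 yz; rewrite lerD2r ler_pM2l ?subr_gt0//; exact: f_decr.
Qed.

Let g_ge y : 0 <= y -> d * K <= g y.
Proof. by move=> y0; rewrite lerDr mulr_ge0 ?f_ge0// subr_ge0 ltW. Qed.

Let gK : g K = K. Proof. by rewrite /g fK; ring. Qed.

Let g_continuous y : 0 < y -> {for y, continuous g}.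
Proof.
move=> y0; apply: cvgD; last exact: cvg_cst.
by apply: cvgM; [exact: cvg_cst|exact: f_continuous].
Qed.

Let near_tail (P : R -> Prop) : (\forall t \near +oo, P t) ->
  exists T, 0 < T /\ forall t, T <= t -> P (t - tau).
Proof.
(* The [tau] absorbs the delay, the [1] makes the bound by [M] strict, and the [0] keeps [T] in the
   range [t > 0] where the equation holds. *)
move=> [M [_ MP]]; exists (Num.max 0 M + tau + 1); split.
  by rewrite ltr_wpDl// addr_ge0 ?le_max ?lexx// ltW.
move=> t Tt; apply: MP.
have : M <= Num.max 0 M by rewrite le_max lexx orbT.
by lra.
Qed.

Let x_derive t : 0 < t -> is_derive t 1 x (- x t + f (x (t - tau))).
Proof. by case: x_sol => _ _; exact. Qed.

Let near_le_g a e : 0 <= a <= K -> (\forall t \near +oo, a <= x t) -> 0 < e ->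
  \forall t \near +oo, x t <= g a + e.
Proof.
move=> /andP[a0 aK] /near_tail[T [T0 ax]] e0.
apply: (@near_le_mean R x (fun t => f (x (t - tau))) _ _ _ T) => //.
- by rewrite -[X in X <= _]fK; exact: f_decr.
- by move=> t Tt; apply: x_derive; exact: lt_le_trans Tt.
- by move=> t Tt; apply: f_decr => //; exact: ax.
- by move=> t _ Kx; rewrite -[X in _ <= X]fK; apply: f_decr => //; exact: ltW.
Qed.

Let near_ge_g b e : K <= b -> (\forall t \near +oo, x t <= b) -> 0 < e ->
  \forall t \near +oo, g b - e <= x t.
Proof.
move=> Kb /near_tail[T [T0 xb]] e0.
have x_ge0 t : T <= t -> 0 <= x (t - tau).
  by case: x_sol => x0 _ _ Tt; apply: x0; have := tau_gt0; lra.
apply: (@near_ge_mean R x (fun t => f (x (t - tau))) _ _ _ T) => //.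
- by rewrite -[X in _ <= X]fK; apply: f_decr => //; exact: ltW.
- by move=> t Tt; apply: x_derive; exact: lt_le_trans Tt.
- by move=> t Tt; apply: f_decr; [exact: x_ge0|exact: xb].
- move=> t Tt xK; rewrite -[X in X <= _]fK; apply: f_decr => //.
  by apply: x_ge0; rewrite (le_trans _ Tt)// lerDl ltW.
Qed.

Lemma solution_attracted : exists a, [/\ 0 < a <= K, g (g a) <= a &
  forall e, 0 < e -> \forall t \near +oo, a - e <= x t <= g a + e].
Proof.
have dK_gt0 : 0 < d * K by exact: mulr_gt0.
have dK : d * K <= K by rewrite ger_pMl// ltW.
pose S := [set a | 0 <= a <= K /\ \forall t \near +oo, a <= x t].
have S0 : S 0.
  split; first by rewrite lexx ltW.
  near=> t; case: x_sol => + _ _; apply.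
  by near: t; exact/nbhs_pinfty_ge/num_real.
have Kg a : 0 <= a <= K -> K <= g a.
  by case/andP=> a0 aK; rewrite -[X in X <= _]gK; exact: g_decr.
(* Two passes through [g]: the lower bound [a] makes [b] an eventual upper bound, which makes
   [g b - e] an eventual lower bound. *)
have gS a b e : S a -> g a < b -> 0 < e -> 0 <= g b - e -> S (g b - e).
  move=> [aK ax] gb e0 gbe.
  have Kb : K <= b := le_trans (Kg a aK) (ltW gb).
  split.
    rewrite gbe lerBlDr (@le_trans _ _ K) ?lerDl ?(ltW e0)//.
    by rewrite -[X in _ <= X]gK; apply: g_decr => //; exact: ltW.
  apply: near_ge_g => //.
  have /(near_le_g aK ax) : 0 < b - g a by rewrite subr_gt0.
  by apply: filterS => t; rewrite subrKC.
have hS : has_sup S by split; [exists 0|exists K => a [/andP[]]].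
set s := sup S.
have g01 : 0 <= g 0 + 1.
  by rewrite addr_ge0// (le_trans _ (g_ge (lexx 0)))// ltW.
(* The trivial bound [0] is improved once: as [g >= d * K], it yields an element of [S] no smaller
   than [d * K / 2]. Positivity of [s] gives access to the continuity of [g] at [s]. *)
have s_gt0 : 0 < s.
  have Sm : S (g (g 0 + 1) - d * K / 2).
    apply: (gS 0) => //; first by rewrite ltrDl.
      by rewrite divr_gt0.
    by have := g_ge g01; lra.
  apply: lt_le_trans (sup_upper_bound hS Sm).
  by have := g_ge g01; lra.
have sK : s <= K by apply: ge_sup; [exists 0|move=> a [/andP[]]].
have near_s e : 0 < e -> exists2 a, S a & g a < g s + e.
  move=> e0; have /nbhs_ballP[r /= r0 rP] : \forall y \near s, g y < g s + e.
    by apply: (cvgr_lt _ (g_continuous s_gt0)); rewrite ltrDl.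
  have [a Sa sa] := sup_adherent r0 hS; exists a => //; apply: rP.
  rewrite /ball/= ger0_norm ?subr_ge0 ?sup_upper_bound//.
  by move: sa; rewrite -/s; lra.
have gs_gt0 : 0 < g s := lt_le_trans dK_gt0 (g_ge (ltW s_gt0)).
exists s; split; first by rewrite s_gt0.
(* If [s < g (g s)], continuity keeps [g (g s + e) - e] above [s] for small [e], and by [gS] this
   number belongs to [S]. *)
- rewrite leNgt; apply/negP => sgg.
  have : \forall e \near 0^'+, s < g (g s + e) - e.
    apply: (@cvgr_gt _ _ _ _ _ (g (g s) - 0)); last by rewrite subr0.
    apply: cvgB; last exact: cvg_at_right_filter.
    apply: (@cvg_comp _ _ _ (fun e => g s + e) g _ (nbhs (g s)));
      last exact: g_continuous.
    have : g s + e @[e --> 0^'+] --> g s + 0.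
      by apply: cvgD; [exact: cvg_cst|exact: cvg_at_right_filter].
    by rewrite addr0.
  move=> gge; near (0 : R)^'+ => e.
  have e0 : 0 < e by near: e; exact: nbhs_right_gt.
  have se : s < g (g s + e) - e by near: e.
  have [a Sa gae] := near_s e e0.
  have Sv := gS a (g s + e) e Sa gae e0 (ltW (lt_trans s_gt0 se)).
  by have := sup_upper_bound hS Sv; rewrite leNgt se.
- move=> e e0; have [a [aK ax] gae] := near_s (e / 2) (divr_gt0 e0 (ltr0n _ 2)).
  have [b [_ bx] sb] := sup_adherent e0 hS.
  have gx := near_le_g aK ax (divr_gt0 e0 (ltr0n _ 2)).
  near=> t.
  have xt : x t <= g a + e / 2 by near: t.
  have bt : b <= x t by near: t.
  by apply/andP; split; move: sb; rewrite -/s; lra.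
Unshelve. all: by end_near. Qed.

End delay_equation.

(** * Monotonicity, tangent inequality and fixed point of an S-map *)

Section S_map_theory.
Variables (R : realType) (f : R -> R).
Implicit Types x y t b : R.

Lemma is_derive_derivI (h : R -> R) x : 0 < x -> derivableI h x ->
  is_derive x 1 h (derivI h x).
Proof.
move=> x0; have [hx hE] := derivIE h x0 => /hx dh.
by rewrite hE; apply: DeriveDef => //; rewrite derive1E.
Qed.

(** Multiplying the convergent difference quotient by the increment recovers [h x - h 0]. *)
Lemma derivableI_right_continuous (h : R -> R) : derivableI h 0 ->
  h x @[x --> 0^'+] --> h 0.
Proof.
move=> /cvg_ex[l hl].
have hl' : x^-1 * (h (x + 0) - h 0) @[x --> (0 : R)^'+] --> l.
  apply: cvg_trans hl; apply: cvg_app => A A0.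
  have {}A0 : \forall x \near (0 : R), x != 0 -> 0 <= x + 0 -> A x := A0.
  near=> x; have x0 : 0 < x by near: x; exact: nbhs_right_gt.
  have : x != 0 -> 0 <= x + 0 -> A x by near: x; apply: cvg_within; exact: A0.
  by apply; [rewrite gt_eqF|rewrite addr0 ltW].
have x0 : x @[x --> (0 : R)^'+] --> (0 : R) by exact: cvg_at_right_filter.
have lim : x * (x^-1 * (h (x + 0) - h 0)) + h 0 @[x --> (0 : R)^'+]
    --> 0 * l + h 0.
  by apply: cvgD; [exact: cvgM|exact: cvg_cst].
rewrite mul0r add0r in lim.
apply: cvg_trans lim; apply: near_eq_cvg; near=> x.
have x_gt0 : 0 < x by near: x; exact: nbhs_right_gt.
by rewrite /= addr0 mulrA divff ?gt_eqF// mul1r subrK.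
Unshelve. all: by end_near. Qed.

Hypothesis Sf : S_map f.

Lemma S_map_is_derive (n : nat) x : (n < 3)%N -> 0 < x ->
  is_derive x 1 (derivnI n f) (derivnI n.+1 f x).
Proof.
move=> n3 x0; apply: is_derive_derivI => //.
by case: Sf => _ + _ _; apply => //; exact: ltW.
Qed.

Lemma S_map_decr x y : 0 <= x -> x < y -> f y < f x.
Proof.
case: Sf => _ fd _ f1_lt0.
have decr a b : 0 < a -> a < b -> f b < f a.
  move=> a0 ab; rewrite -subr_lt0.
  have [z /andP[az _]|c /andP[ac _] ->] :=
      mvt_closed ab (f := f) (df := derivI f).
    by apply: (S_map_is_derive (n := 0)) => //; exact: lt_le_trans az.
  by rewrite pmulr_llt0 ?subr_gt0// f1_lt0// ltW// (lt_trans a0).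
(* At the endpoint [0] monotonicity passes to the limit by right continuity; the detour through
   [y / 2] keeps the inequality strict. *)
rewrite le_eqVlt => /orP[/eqP <- y0|]; last exact: decr.
have y20 : 0 < y / 2 by lra.
apply: (@lt_le_trans _ _ (f (y / 2))); first by apply: decr => //; lra.
rewrite leNgt; apply/negP => f0.
have f0c := derivableI_right_continuous (fd 0%N 0 isT (lexx 0)).
near (0 : R)^'+ => z.
have : f z < f (y / 2) by near: z; exact: (cvgr_lt _ f0c).
have z0 : 0 < z by near: z; exact: nbhs_right_gt.
have zy : z < y / 2 by near: z; exact: nbhs_right_lt.
by rewrite ltNge (ltW (decr _ _ z0 zy)).
Unshelve. all: by end_near. Qed.

Lemma S_map_gt0 x : 0 <= x -> 0 < f x.
Proof.
move=> x0; have : f (x + 1) < f x by apply: S_map_decr; lra.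
by apply: le_lt_trans; case: Sf => + _ _ _; apply; lra.
Qed.

Lemma S_map_continuous x : 0 < x -> {for x, continuous f}.
Proof.
by move=> x0; apply: is_derive_continuous; exact: (@S_map_is_derive 0).
Qed.

Lemma S_map_tangent_lt b t : 0 < b -> 0 < t -> t != b ->
  derivI f b < (f t - f b) / (t - b) *
               (1 - derivnI 2 f b / (2 * derivI f b) * (t - b)).
Proof.
case: Sf => _ _ Sf0 f10.
have lt := @tangent_lt R f (derivnI 1 f) (derivnI 2 f) (derivnI 3 f)
  (fun x => @S_map_is_derive 0 x isT) (fun x => @S_map_is_derive 1 x isT)
  (fun x => @S_map_is_derive 2 x isT) (fun x px => f10 x (ltW px))
  (fun x px => Sf0 x (ltW px)).
exact: lt.
Qed.

Lemma S_map_fixed_point : exists2 K, 0 < K & unique (fixed_point f) K.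
Proof.
have f1 : 0 < f 1 by apply: S_map_gt0.
have f_le x y : 0 <= x -> x <= y -> f y <= f x.
  move=> x0; rewrite le_eqVlt => /orP[/eqP <-//|xy].
  by apply/ltW/S_map_decr.
(* Since [f] is decreasing, [a <= f 1 <= f a] and [f b <= f 1 <= b]. The interval avoids [0], as
   continuity is only available at positive points. *)
pose a := Num.min 1 (f 1); pose b := Num.max 1 (f 1).
have a0 : 0 < a by rewrite lt_min ltr01.
have a1 : a <= 1 by rewrite ge_min lexx.
have af : a <= f 1 by rewrite ge_min lexx orbT.
have b1 : 1 <= b by rewrite le_max lexx.
have bf : f 1 <= b by rewrite le_max lexx orbT.
have [|||K /andP[aK Kb] KE] := @ivt_point R (fun x => f x - x) a b 0.
- exact: le_trans b1.
- move=> x /andP[ax xb]; have x0 : 0 < x by exact: lt_le_trans ax.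
  by apply: cvgB; [exact: S_map_continuous|exact: cvg_id].
- right; rewrite subr_le0 subr_ge0; apply/andP; split.
    by rewrite (le_trans _ bf)// f_le.
  by rewrite (le_trans af)// f_le// ltW.
have K0 : 0 < K by exact: lt_le_trans aK.
have fK : f K = K by apply/eqP; rewrite -subr_eq0 KE.
exists K => //; split; first by split; [exact: ltW|].
move=> y [y0 fy]; have [Ky|yK|//] := ltgtP K y.
- by have := S_map_decr (ltW K0) Ky; rewrite fK fy; lra.
- by have := S_map_decr y0 yK; rewrite fK fy; lra.
Qed.

End S_map_theory.

(** * Lower and upper limits along a filter *)

Section limf.
Variables (R : realType) (T : choiceType) (X : filteredType T).
Implicit Types (F : set_system X) (x : X -> R) (b : R).
Local Open Scope ereal_scope.

Lemma limf_esup_le F x b :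
  (forall e, (0 < e)%R -> \forall t \near F, (x t <= b + e)%R) ->
  limf_esup (EFin \o x) F <= b%:E.
Proof.
move=> xb; apply/lee_addgt0Pr => e e0; rewrite limf_esupE.
apply: (@le_trans _ _ (ereal_sup ((EFin \o x) @` [set t | (x t <= b + e)%R]))).
  by apply: ereal_inf_lbound; exists [set t | (x t <= b + e)%R] => //; exact: xb.
by apply: ge_ereal_sup => _ [t /= xt <-]; rewrite lee_fin.
Qed.

Lemma limf_einf_ge F x b :
  (forall e, (0 < e)%R -> \forall t \near F, (b - e <= x t)%R) ->
  b%:E <= limf_einf (EFin \o x) F.
Proof.
move=> xb; apply/lee_subgt0Pr => e e0; rewrite limf_einfE.
apply: (@le_trans _ _ (ereal_inf ((EFin \o x) @` [set t | (b - e <= x t)%R]))).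
  by apply: le_ereal_inf_tmp => _ [t /= xt <-]; rewrite lee_fin.
by apply: ereal_sup_ubound; exists [set t | (b - e <= x t)%R] => //; exact: xb.
Qed.

(** Any two members of a proper filter share a point, whose value separates the infimum over one
    from the supremum over the other. *)
Lemma limf_einf_le_esup F (FF : ProperFilter F) (f : X -> \bar R) :
  limf_einf f F <= limf_esup f F.
Proof.
rewrite limf_einfE limf_esupE.
apply: ge_ereal_sup => _ [A FA <-]; apply: le_ereal_inf_tmp => _ [B FB <-].
have [t [At Bt]] := filter_ex (filterI FA FB).
apply: (@le_trans _ _ (f t)).
  by apply: ereal_inf_lbound; exists t.
by apply: ereal_sup_ubound; exists t.
Qed.
End limf.

Theorem corollary7 (R : realType) (tau : R) (f : R -> R) :
  0 < tau -> S_map f ->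
  exists K : R, unique (fixed_point f) K /\
    let g := fun y : R => (1 - expR (- tau)) * f y + expR (- tau) * K in
    ((1 - expR (- tau)) * `|derivI f K| <= 1 ->
       forall x : R -> R, nonneg_solution tau f x -> x t @[t --> +oo] --> K)
    /\
    ((1 - expR (- tau)) * `|derivI f K| > 1 ->
       exists alpha1 beta1 : R,
         [/\ alpha1 < beta1,
             unique (two_cycle g) [set alpha1; beta1]
           & forall x : R -> R, nonneg_solution tau f x ->
               (alpha1%:E <= limf_einf (EFin \o x) +oo%R
                /\ limf_einf (EFin \o x) +oo%R <= limf_esup (EFin \o x) +oo%R
                /\ limf_esup (EFin \o x) +oo%R <= beta1%:E)%E]).
Proof.
move=> tau0 Sf; have [K K0 KU] := S_map_fixed_point Sf; exists K; split => // g.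
have [_ fK] := KU.1.
have [f_ge0 _ _ f1_lt0] := Sf.
pose d := expR (- tau); have d0 : 0 < d := expR_gt0 _.
have d1 : d < 1 by rewrite expR_lt1 oppr_lt0.
have dC : 0 < 1 - d by rewrite subr_gt0.
pose g1 y := (1 - d) * derivI f y.
have f_decr (y z : R) : 0 <= y -> y <= z -> f z <= f y.
  move=> y0; rewrite le_eqVlt => /orP[/eqP <-//|yz].
  exact/ltW/S_map_decr.
have g_decr (y z : R) : 0 <= y -> y <= z -> g z <= g y.
  by move=> y0 yz; rewrite lerD2r ler_pM2l//; exact: f_decr.
have gg1 (y : R) : 0 < y -> is_derive y 1 g (g1 y).
  move=> y0; have ? : is_derive y 1 f (derivI f y) :=
    S_map_is_derive Sf (n := 0) isT y0.
  by apply: is_derive_eq; rewrite /GRing.scale/= /g1 /d; ring.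
have g1_lt0 (y : R) : 0 < y -> g1 y < 0.
  by move=> y0; rewrite pmulr_rlt0// f1_lt0// ltW.
(* The inequality for [f] is homogeneous and involves only increments, so it passes to [g] with the
   same coefficient. *)
have g_tangent (b t : R) : 0 < b -> 0 < t -> t != b -> g1 b <
    (g t - g b) / (t - b) * (1 - derivnI 2 f b / (2 * derivI f b) * (t - b)).
  move=> b0 t0 tb.
  have -> : g t - g b = (1 - d) * (f t - f b) by rewrite /g -/d; ring.
  by rewrite -!mulrA ltr_pM2l// !mulrA; exact: S_map_tangent_lt.
have m0 : 0 < d * K by exact: mulr_gt0.
have g_gtm (y : R) : 0 <= y -> d * K < g y.
  by move=> y0; rewrite ltrDr mulr_gt0//; exact: S_map_gt0.
have g_gtm' (y : R) : 0 < y -> d * K < g y by move/ltW; exact: g_gtm.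
have gK : g K = K by rewrite /g fK; ring.
have g1K : (1 - d) * `|derivI f K| = - g1 K.
  by rewrite ltr0_norm ?f1_lt0 ?ltW// mulrN.
have g1K0 := g1_lt0 K K0.
have attracted x : nonneg_solution tau f x -> exists a,
    [/\ 0 < a, a <= K, g (g a) <= a &
     forall e, 0 < e -> \forall t \near +oo, a - e <= x t <= g a + e].
  move=> x_sol; have [a [/andP[a0 aK] ga ax]] :=
    solution_attracted tau0 f_decr (S_map_continuous Sf) f_ge0 K0 fK x_sol.
  by exists a.
rewrite -/d g1K; split => [K_attracting|K_repelling] /=.
  move=> x /attracted[a [a0 aK ga ax]].
  (* A lower end [a < K] would force [g1 K ^+ 2 > 1]; so [a = K], and the attracting interval
     shrinks to a point. *)
  move: aK; rewrite le_eqVlt => /orP[/eqP aE|aK]; last first.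
    by have := gg_le_repelling gg1 g1_lt0 g_tangent m0 g_gtm' gK a0 aK ga; nra.
  apply/cvgrPdist_le => e e0; have := ax e e0; rewrite aE gK.
  by apply: filterS => t; rewrite distrC ler_distl.
have {}K_repelling : 1 < g1 K ^+ 2 by nra.
have unique_below :=
  gg_fixed_unique gg1 g1_lt0 g_tangent m0 g_gtm' K0 gK K_repelling.
have [a [a0 aK ga]] := gg_fixed_exists gg1 m0 g_gtm' K0 gK K_repelling.
have aga : a < g a.
  by rewrite (lt_le_trans aK)// -[X in X <= _]gK; apply: g_decr => //; exact: ltW.
exists a, (g a); split => //.
  split.
    exists a, (g a); split => //; split => //; [exact: ltW| |by rewrite lt_eqF].
    by rewrite ltW// (lt_trans m0)// g_gtm'.
  move=> _ [p [q [[p0 q0 pq gp gq] ->]]].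
  (* The smaller point of a cycle lies below [K], since [K <= u] would give [v = g u <= K <= u]. It
     is positive as a value of [g], so it is the unique fixed point of the second iterate below
     [K]. *)
  have cycleE (u v : R) : 0 <= u -> u < v -> g u = v -> g v = u -> u = a /\ v = g a.
    move=> u0 uv gu gv; have uK : u < K.
      rewrite ltNge; apply/negP => Ku.
      by have := g_decr _ _ (ltW K0) Ku; rewrite gu gK; lra.
    have u_gt0 : 0 < u.
      by rewrite -gv (lt_trans m0)// g_gtm// (le_trans u0)// ltW.
    have ua : u = a by apply: unique_below => //; rewrite /= gu.
    by rewrite -gu ua.
  move: pq; rewrite neq_lt => /orP[pq|qp].
    by have [-> ->] := cycleE p q p0 pq gp gq.
  by have [-> ->] := cycleE q p q0 qp gq gp; rewrite setUC.
move=> x /attracted[b [b0 bK gb bx]].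
(* There is a fixed point of the second iterate in []0, b]]; if [b < K], it must be [a] by
   uniqueness. *)
have ab : a <= b.
  have [q /andP[q0 qb] qE] := gg_fixed_le gg1 m0 g_gtm' b0 gb.
  have [bK'|Kb] := ltP b K; last by rewrite (le_trans _ Kb)// ltW.
  suff -> : a = q by [].
  by apply: unique_below => //; exact: le_lt_trans bK'.
have gba : g b <= g a by apply: g_decr => //; exact: ltW.
split; last split.
- apply: limf_einf_ge => e e0; apply: filterS (bx e e0) => t /andP[? _]; lra.
- exact: limf_einf_le_esup.
- apply: limf_esup_le => e e0; apply: filterS (bx e e0) => t /andP[_ ?]; lra.
Qed.
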